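(* Let $\sigma>0$, $a>0$, $\xi_0<\xi_1$, $\Delta=\xi_1-\xi_0$, and $f(t)=e^{2\pi i\xi_0t}+ae^{2\pi i\xi_1t}$. Let $t_k^+=k/\Delta$, $k\in\mathbb{Z}$. Let $s>0$ solve $$\ln\frac{s}{a}=\frac12\left(s-\frac1s\right),$$ and set $$\Delta_{\mathrm{critical,\,STFT}}=\frac{1+s}{\pi\sigma\sqrt{2s}}.$$ Then, for every $k\in\mathbb{Z}$, the map $\eta\mapsto |V_f^{(h)}(t_k^+,\eta)|$ on $\mathbb{R}$ has one local maximum when $\Delta\le\Delta_{\mathrm{critical,\,STFT}}$, and two local maxima when $\Delta>\Delta_{\mathrm{critical,\,STFT}}$.
   Context: The window is the Gaussian $h(x)=\frac{1}{\sigma\sqrt{\pi}}e^{-x^2/\sigma^2}$. The (modified) short-time Fourier transform is $V_f^{(h)}(t,\eta)=\int_{-\infty}^\infty f(x)h(x-t)e^{-2\pi i\eta(x-t)}dx$, so that here $V_f^{(h)}(t,\eta)=e^{2\pi i\xi_0t}\left(e^{-\pi^2\sigma^2(\eta-\xi_0)^2}+ae^{2\pi i\Delta t}e^{-\pi^2\sigma^2(\eta-\xi_1)^2}\right)$. The times $t_k^+=k/\Delta$ are called constructive times. *)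

(* Defs.v *)
From HB Require Import structures.
From mathcomp Require Import all_boot all_order all_algebra.
From mathcomp Require Import all_classical all_reals all_analysis.
From mathcomp Require Import complex.

Set Implicit Arguments.
Unset Strict Implicit.
Unset Printing Implicit Defensive.

Import Order.TTheory GRing.Theory Num.Theory.
Import numFieldNormedType.Exports.

Local Open Scope classical_set_scope.
Local Open Scope ring_scope.
Local Open Scope complex_scope.

Definition expi (R : realType) (theta : R) : R[i] := cos theta +i* sin theta.

Definition cmodulus (R : realType) (z : R[i]) : R := Normc.normc z.

(* Componentwise Lebesgue integral over the real line; meaningful only when both
   components are integrable. *)
Definition cintegral (R : realType) (F : R -> R[i]) : R[i] :=
  (\int[lebesgue_measure]_(x in setT) complex.Re (F x))%R +i*
  (\int[lebesgue_measure]_(x in setT) complex.Im (F x))%R.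

Definition gaussian_window (R : realType) (sigma x : R) : R :=
  (sigma * Num.sqrt pi)^-1 * expR (- (x ^+ 2 / sigma ^+ 2)).

(* The phase is relative to the window centre t, as in the modified STFT. *)
Definition stft (R : realType) (h : R -> R) (f : R -> R[i]) (t eta : R) : R[i] :=
  cintegral (fun x => f x * (h (x - t))%:C * expi (- (2 * pi * eta * (x - t)))).

Definition two_tone (R : realType) (a xi0 xi1 t : R) : R[i] :=
  expi (2 * pi * xi0 * t) + a%:C * expi (2 * pi * xi1 * t).

Definition constructive_time (R : realType) (Delta : R) (k : int) : R :=
  k%:~R / Delta.

Definition Delta_critical_STFT (R : realType) (sigma s : R) : R :=
  (1 + s) / (pi * sigma * Num.sqrt (2 * s)).

Definition local_maximum (R : realType) (g : R -> R) (x : R) : Prop :=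
  \forall y \near x, g y <= g x.

Definition has_n_local_maxima (R : realType) (n : nat) (g : R -> R) : Prop :=
  ([set x | local_maximum g x] #= `I_n)%card.

(* Main.v *)
Require Import Defs.
From mathcomp Require Import all_boot all_order all_algebra.
From mathcomp Require Import all_classical all_reals all_analysis.
From mathcomp Require Import measurable_realfun complex ring lra.

Import Order.TTheory GRing.Theory Num.Theory.
Import numFieldNormedType.Exports.

Local Open Scope classical_set_scope.
Local Open Scope ring_scope.

(** At a constructive time the relative phase of the two tones is a multiple of
    2 pi, so the modulus of the transform is a sum of two Gaussian bumps of the
    same width, one at each frequency, with heights 1 and a
    ([cmodulus_stft_constructive_time]). This rests on the Fourier transform of
    the Gaussian window ([Rintegral_window_cos]), which is obtained from the
    linear differential equation that it satisfies.

    In the normalised frequency v = (eta - xi0) / Delta the bumps sit at 0 and 1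
    and share the sharpness c = pi^2 sigma^2 Delta^2. The slope of their sum is
    positive for v <= 0, negative for v >= 1, and in between has the sign of
    ln a - (logit v - c (2 v - 1)), where logit v = ln v - ln (1 - v)
    ([mixture_slope_sign]). The critical points are thus the intersections of the
    logit curve with the line of slope 2 c through the point (1/2, ln a). The curve
    is antisymmetric about (1/2, 0), concave on the left half and convex on the
    right half; hence, for each height ln a, there is one slope at which such a
    line is tangent to the curve, flatter lines cross it once and steeper ones
    three times. Three crossings make two maxima separated by a minimum; at a
    point of tangency the slope of the sum vanishes without changing sign, unless
    that point is itself the crossing.

    The equation for s says that the line with c0 = (1 + s)^2 / (2 s) is tangent to
    the curve at p = s / (1 + s) ([ln_amplitude_tangent]), and c <= c0 is the
    condition Delta <= Delta_critical ([le_Delta_critical_STFT]). The difference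
    logit v - c (2 v - 1) is monotone between its turning points b and 1 - b, and
    comparing its values there with ln a decides between one crossing
    ([subcritical_one_cross]) and three ([supercritical_three_cross]). *)

(** * An improper integral of a derivative *)

Section integral_of_derivative.
Context {R : realType}.
Notation mu := (@lebesgue_measure R).

(** This is integration by parts on the whole line without boundary terms: the
    fundamental theorem on [-n-1, n+1], with dominated convergence in n. *)
Lemma Rintegral_derive_eq0 (F f : R -> R) :
  (forall x : R, is_derive x 1 F (f x)) -> continuous f ->
  mu.-integrable setT (EFin \o f) ->
  F x @[x --> +oo] --> (0 : R) -> F x @[x --> -oo] --> (0 : R) ->
  \int[mu]_(x in setT) f x = 0.
Proof.
move=> dF cf intf Fy FNy.
have cF : continuous F.
  by move=> x; apply/differentiable_continuous/derivable1_diffP; have [] := dF x.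
have FTC n : (\int[mu]_(x in `[(- n.+1%:R)%R, n.+1%:R%R]) (f x)%:E)%E =
    (F n.+1%:R - F (- n.+1%:R))%:E.
  rewrite (@continuous_FTC2 _ _ F) ?EFinB//.
  - by rewrite gtrN ?ltr0n.
  - exact: continuous_subspaceT.
  - split=> [x _||]; first by have [] := dF x.
    + exact: cvg_at_right_filter (cF _).
    + exact: cvg_at_left_filter (cF _).
  - by move=> x _; rewrite derive1E; have [] := dF x.
pose f_ (n : nat) := (EFin \o f) \_ `[(- n.+1%:R)%R, n.+1%:R%R].
have /integrableP[mf _] := intf.
have mf_ n : measurable_fun setT (f_ n).
  apply: (measurable_restrictT (EFin \o f) _).1 => //; exact: measurable_funTS.
have [| |_ _ lim_f] := @dominated_convergence _ _ _ mu setT measurableT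
    f_ (EFin \o f) (abse \o (EFin \o f)) mf_ mf _ (integrable_abse intf).
- apply: aeW => x _; apply: cvg_near_cst; near=> n.
  rewrite /f_ patchE mem_set//= in_itv/= -ler_norml.
  apply: (@le_trans _ _ n%:R); last by rewrite ler_nat.
  near: n; exact: nbhs_infty_ger.
- apply: aeW => x n _; rewrite /f_ patchE; case: ifPn => // _.
  by rewrite [leLHS]abse0; exact: abse_ge0.
have F0 : (F n.+1%:R - F (- n.+1%:R))%:E @[n --> \oo] --> (0%R : R)%:E.
  rewrite -[X in X%:E](subr0 (0 : R)); apply: cvg_EFin; first exact: nearW.
  have n1y : (n.+1%:R : R) @[n --> \oo] --> +oo.
    by rewrite (cvg_shiftS (fun n => n%:R : R)); exact: cvgr_idn.
  apply: cvgB; first exact: cvg_comp n1y Fy.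
  by apply: cvg_comp FNy; apply/cvgNry; rewrite opprK.
rewrite /Rintegral; suff -> : (\int[mu]_x (f x)%:E = 0)%E by [].
apply: (cvg_unique _ lim_f) => //.
apply: cvg_trans F0; apply: near_eq_cvg; near=> n.
by rewrite /= /f_ -FTC integral_mkcond.
Unshelve. all: end_near. Qed.
End integral_of_derivative.

(** * The Gaussian window *)

Section window.
Context {R : realType}.
Notation mu := (@lebesgue_measure R).
Variables (sigma t : R).
Hypothesis sigma_gt0 : 0 < sigma.
Local Notation w x := (gaussian_window sigma (x - t)).

Lemma gaussian_window_ge0 x : 0 <= gaussian_window sigma x.
Proof. by rewrite mulr_ge0 ?expR_ge0// invr_ge0 mulr_ge0 ?sqrtr_ge0// ltW. Qed.

(** The window is a normal density, of variance sigma^2 / 2; its mass and its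
    integrability are those of that density. *)
Lemma gaussian_window_normal_pdf :
  (fun x => w x) = normal_pdf t (sigma / Num.sqrt 2).
Proof.
have s2 : 0 < Num.sqrt 2 :> R by rewrite sqrtr_gt0.
have q2 : (sigma / Num.sqrt 2) ^+ 2 *+ 2 = sigma ^+ 2.
  by rewrite exprMn exprVn sqr_sqrtr// -mulr_natr divfK.
apply/funext => x; rewrite normal_pdfE ?mulf_neq0 ?invr_eq0 ?gt_eqF//.
rewrite /normal_peak /normal_fun -mulrnAl q2 /gaussian_window mulNr.
by rewrite sqrtrM ?sqr_ge0// sqrtr_sqr gtr0_norm.
Qed.

Lemma continuous_window : continuous (fun x => w x).
Proof.
rewrite gaussian_window_normal_pdf; apply: continuous_normal_pdf.
by rewrite mulf_neq0 ?invr_eq0 ?gt_eqF// sqrtr_gt0.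
Qed.

Lemma integrable_window : mu.-integrable setT (EFin \o (fun x => w x)).
Proof. by rewrite gaussian_window_normal_pdf; exact: integrable_normal_pdf. Qed.

Lemma integral_window : \int[mu]_(x in setT) w x = 1.
Proof.
by rewrite /Rintegral; under eq_integral do
  [rewrite -[w _]/((fun x => w x) _) gaussian_window_normal_pdf];
  rewrite integral_normal_pdf.
Qed.

(** The linear factor is absorbed by half of the Gaussian exponent, since
    u <= exp (u^2 / 2); a wider normal density therefore dominates. *)
Lemma normM_window_le x :
  `|x - t| * w x <= sigma * Num.sqrt 2 * normal_pdf t sigma x.
Proof.
set y := x - t; have s0 : sigma != 0 by rewrite gt_eqF.
rewrite normal_pdfE// /normal_peak /normal_fun -/y /gaussian_window.
have -> : Num.sqrt (sigma ^+ 2 * pi *+ 2) = sigma * Num.sqrt pi * Num.sqrt 2.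
  rewrite -mulr_natr sqrtrM; last by rewrite mulr_ge0 ?pi_ge0// sqr_ge0.
  by rewrite sqrtrM ?sqr_ge0// sqrtr_sqr gtr0_norm.
have -> : expR (- (y ^+ 2 / sigma ^+ 2)) =
   expR (- y ^+ 2 / (sigma ^+ 2 *+ 2)) * expR (- ((y / sigma) ^+ 2 / 2)).
  by rewrite -expRD; congr expR; field.
have : `|y| / sigma * expR (- ((y / sigma) ^+ 2 / 2)) <= 1.
  rewrite expRN ler_pdivrMr ?expR_gt0// mul1r.
  apply: le_trans (expR_ge1Dx _).
  have -> : (y / sigma) ^+ 2 = (`|y| / sigma) ^+ 2.
    by rewrite !exprMn real_normK ?num_real.
  by have := sqr_ge0 (`|y| / sigma - 1); lra.
have s2 : 0 < Num.sqrt 2 :> R by rewrite sqrtr_gt0.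
have pi0 : 0 < Num.sqrt pi :> R by rewrite sqrtr_gt0 pi_gt0.
set E1 := expR (- y ^+ 2 / _); set E2 := expR (- (_ / 2)) => h.
have E0 : 0 <= E1 / Num.sqrt pi by rewrite divr_ge0 ?expR_ge0 ?ltW.
have := ler_wpM2l E0 h; congr (_ <= _).
  by field; rewrite !gt_eqF.
by field; rewrite !gt_eqF.
Qed.

Lemma integrable_mul_window : mu.-integrable setT (EFin \o (fun x => (x - t) * w x)).
Proof.
apply: (@le_integrable _ _ _ mu setT measurableT _
   (EFin \o (fun x => sigma * Num.sqrt 2 * normal_pdf t sigma x))).
- apply/measurable_EFinP; apply: measurable_funM.
    by apply: measurable_funB.
  by apply: continuous_measurable_fun; exact: continuous_window.
- move=> x _ /=; rewrite lee_fin normrM (ger0_norm (gaussian_window_ge0 _)).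
  by apply: le_trans (normM_window_le x) _; exact: ler_norm.
- rewrite /comp; under eq_fun do rewrite EFinM.
  apply: integrableZl => //; exact: integrable_normal_pdf.
Qed.

Lemma cvg_window_pm :
  w x @[x --> +oo] --> (0 : R) /\ w x @[x --> -oo] --> (0 : R).
Proof.
have wE : (fun x => w x) = (fun x =>
    (sigma * Num.sqrt pi)^-1 * gauss_fun ((x - t) / sigma)).
  by apply/funext => x; rewrite /gauss_fun exprMn exprVn.
rewrite !wE -[X in _ @[_ --> +oo] --> X](mulr0 (sigma * Num.sqrt pi)^-1).
rewrite -[X in _ @[_ --> -oo] --> X](mulr0 (sigma * Num.sqrt pi)^-1).
split; apply: cvgM; [exact: cvg_cst| |exact: cvg_cst|].
  apply: cvg_comp cvg_gauss_fun.
  by apply/gt0_cvgMly; [rewrite invr_gt0|exact: cvg_addrr].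
rewrite [X in X @ _ --> _](_ : _ =
  (fun x => gauss_fun (- ((x - t) / sigma)))); last first.
  by apply/funext=> x; rewrite /gauss_fun sqrrN.
apply: cvg_comp cvg_gauss_fun.
apply/cvgNrNy; rewrite [X in X @ _ --> _](_ : _ = (fun x => (x - t) / sigma)).
  by apply/gt0_cvgMlNy; [rewrite invr_gt0|exact: cvg_addrr_Ny].
by apply/funext => x; exact: opprK.
Qed.

End window.

(** * The Fourier transform of the window *)

Section integrable_mul.
Context {R : realType}.
Notation mu := (@lebesgue_measure R).

Lemma integrableM_bounded (f g : R -> R) :
  mu.-integrable setT (EFin \o f) -> continuous g -> (forall x, `|g x| <= 1) ->
  mu.-integrable setT (EFin \o (fun x => f x * g x)).
Proof.
move=> fi cg g1; apply: (@le_integrable _ _ _ mu setT measurableT _ (EFin \o f)) => //.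
- apply/measurable_EFinP; apply: measurable_funM.
    by apply/measurable_EFinP; case/integrableP: fi.
  exact: continuous_measurable_fun.
- by move=> x _ /=; rewrite lee_fin normrM ler_piMr.
Qed.

Lemma continuous_affine (b t theta : R) :
  continuous (fun x : R => b * (x - t) + theta).
Proof.
move=> x; apply/differentiable_continuous/derivable1_diffP.
by apply: ex_derive.
Qed.

End integrable_mul.

Section fourier_gaussian.
Context {R : realType}.
Notation mu := (@lebesgue_measure R).
Variables (sigma t theta : R).
Hypothesis sigma_gt0 : 0 < sigma.
Local Notation w x := (gaussian_window sigma (x - t)).

Let phase (b x : R) : R := b * (x - t) + theta.

Let continuous_cos_phase b : continuous (fun x => cos (phase b x)).
Proof.
by move=> x; apply: (@continuous_comp _ _ _ (phase b) cos);
  [exact: continuous_affine|exact: continuous_cos].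
Qed.

Let continuous_sin_phase b : continuous (fun x => sin (phase b x)).
Proof.
by move=> x; apply: (@continuous_comp _ _ _ (phase b) sin);
  [exact: continuous_affine|exact: continuous_sin].
Qed.

Let I (b : R) : R := \int[mu]_(x in setT) (w x * cos (phase b x)).
Let J (b : R) : R := \int[mu]_(x in setT) ((x - t) * w x * sin (phase b x)).

Let iI b : mu.-integrable setT (EFin \o (fun x => w x * cos (phase b x))).
Proof.
apply: integrableM_bounded; [exact: integrable_window|exact: continuous_cos_phase|].
by move=> x; exact: cos_max.
Qed.

Let iJ b :
  mu.-integrable setT (EFin \o (fun x => (x - t) * w x * sin (phase b x))).
Proof.
apply: integrableM_bounded; [exact: integrable_mul_window|exact: continuous_sin_phase|].
by move=> x; exact: sin_max.
Qed.

(** The derivative in b passes under the integral because the absolute first moment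
    of the window dominates the differentiated integrand for every b. *)
Let dI (b : R) : is_derive b 1 I (- J b).
Proof.
have d1 (c x : R) :
    is_derive c 1 (fun c => w x * cos (phase c x))
      (- ((x - t) * w x * sin (phase c x))).
  apply: is_derive_eq; rewrite /GRing.scale/= /phase; ring.
have p1 (c x : R) : partial1of2 (fun c x => w x * cos (phase c x)) c x =
    - ((x - t) * w x * sin (phase c x)).
  by rewrite partial1of2E; apply: derive_val.
have b1 : `]b - 1, b + 1[%classic b by rewrite /= in_itv/= ltrDl gtrDl ltrN10 ltr01.
have intf c : `]b - 1, b + 1[%classic c ->
   mu.-integrable setT (EFin \o (fun x => w x * cos (phase c x))) by [].
have derf (c x : R) : `]b - 1, b + 1[%classic c -> setT x ->
   derivable ((fun c x => w x * cos (phase c x)) ^~ x) c 1.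
  by move=> _ _; have [] := d1 c x.
have G0 x : 0 <= `|(x - t) * w x| by [].
have iG : mu.-integrable setT (EFin \o (fun x => `|(x - t) * w x|)).
  exact: integrable_abse (integrable_mul_window _ t sigma_gt0).
have Gub c x : `]b - 1, b + 1[%classic c -> setT x ->
    `|partial1of2 (fun c x => w x * cos (phase c x)) c x| <= `|(x - t) * w x|.
  by move=> _ _; rewrite p1 normrN normrM ler_piMr// sin_max.
apply: DeriveDef.
  exact: (derivable_under_integral measurableT b1 intf derf G0 iG Gub).
rewrite -derive1E.
rewrite (differentiation_under_integral measurableT b1 intf derf G0 iG Gub).
rewrite /J; under eq_Rintegral do rewrite p1 -mulN1r.
by rewrite RintegralZl// mulN1r.
Qed.

(** The primitive w x * sin (phase b x) vanishes at both infinities, and its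
    derivative integrates to a multiple of the difference of the two sides. *)
Let JE b : J b = sigma ^+ 2 / 2 * b * I b.
Proof.
have s0 : sigma != 0 by rewrite gt_eqF.
have dF (x : R) : is_derive x 1 (fun x => w x * sin (phase b x))
    (b * (w x * cos (phase b x)) +
     - (2 / sigma ^+ 2) * ((x - t) * w x * sin (phase b x))).
  rewrite /gaussian_window.
  apply: is_derive_eq; rewrite /GRing.scale/= /phase; field.
  by rewrite ?mulf_neq0// gt_eqF// sqrtr_gt0 pi_gt0.
have i1 : mu.-integrable setT (EFin \o (fun x => b * (w x * cos (phase b x)))).
  by rewrite /comp; under eq_fun do rewrite EFinM; exact: (integrableZl _ _ (iI b)).
have i2 : mu.-integrable setT (EFin \o (fun x =>
     - (2 / sigma ^+ 2) * ((x - t) * w x * sin (phase b x)))).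
  by rewrite /comp; under eq_fun do rewrite EFinM; exact: (integrableZl _ _ (iJ b)).
have cw := @continuous_window R sigma t sigma_gt0.
have vanish (G : set_system R) : Filter G -> w x @[x --> G] --> (0 : R) ->
    w x * sin (phase b x) @[x --> G] --> (0 : R).
  move=> FG w0; apply: norm_cvg0.
  apply: (@squeeze_cvgr _ _ _ _ (cst 0) _ _ _ _ _ w0).
    apply: nearW => x; rewrite normr_ge0 normrM /= ger0_norm.
      by rewrite ler_piMr ?sin_max// gaussian_window_ge0.
    exact: gaussian_window_ge0.
  exact: cvg_cst.
have : \int[mu]_(x in setT) (b * (w x * cos (phase b x)) +
     - (2 / sigma ^+ 2) * ((x - t) * w x * sin (phase b x))) = 0.
  apply: Rintegral_derive_eq0 dF _ _ _ _.
  - move=> x; apply: cvgD; apply: cvgM; try exact: cvg_cst.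
      by apply: cvgM; [exact: cw|exact: continuous_cos_phase].
    apply: cvgM; last exact: continuous_sin_phase.
    by apply: cvgM; [apply: cvgB; [exact: cvg_id|exact: cvg_cst]|exact: cw].
  - rewrite /comp; under eq_fun do rewrite EFinD.
    exact: integrableD.
  - by apply: vanish; have [] := cvg_window_pm sigma t sigma_gt0.
  - by apply: vanish; have [] := cvg_window_pm sigma t sigma_gt0.
rewrite RintegralD// RintegralZl// RintegralZl// -/(I b) -/(J b) => h.
have -> : J b = sigma ^+ 2 / 2 * (2 / sigma ^+ 2 * J b) by field.
by rewrite -[RHS]mulrA; congr (_ * _); lra.
Qed.

(** As a function of b the integral solves I' = - (sigma^2 / 2) b I, so its product
    with exp (sigma^2 b^2 / 4) is constant, and at b = 0 the window has mass 1. The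
    free phase theta gives the cosine and the sine transforms together. *)
Lemma Rintegral_window_cos b :
  \int[mu]_(x in setT) (w x * cos (b * (x - t) + theta)) =
  expR (- (sigma ^+ 2 * b ^+ 2 / 4)) * cos theta.
Proof.
rewrite -/(phase b _) -/(I b).
have dK (c : R) :
    is_derive c 1 (fun c => I c * expR (sigma ^+ 2 * c ^+ 2 / 4)) 0.
  have dIc := dI c.
  apply: is_derive_eq; rewrite /GRing.scale/= JE; by field.
have := is_derive_0_is_cst b 0 dK.
rewrite expr0n mulr0 mul0r expR0 mulr1.
have -> : I 0 = cos theta.
  rewrite /I; under eq_Rintegral do rewrite /phase mul0r add0r.
  rewrite RintegralZr//; last exact: integrable_window.
  by rewrite integral_window// mul1r.
by move=> <-; rewrite mulrCA -expRD addNr expR0 mulr1.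
Qed.

End fourier_gaussian.

(** * The transform of the two-tone signal *)

Section stft_value.
Context {R : realType}.
Local Open Scope complex_scope.
Notation mu := (@lebesgue_measure R).

Lemma expiD (x y : R) : expi (x + y) = expi x * expi y.
Proof. by rewrite /expi cosD sinD; simpc; congr Complex; rewrite addrC. Qed.

Lemma expiDint (x : R) (k : int) : expi (x + 2 * pi * k%:~R) = expi x.
Proof.
have per (n : nat) y : expi (y + 2 * pi * n%:R) = expi y :> R[i].
  have -> : 2 * pi * n%:R = pi *+ 2 *+ n :> R.
    by rewrite -[RHS]mulr_natr -[X in _ = X * _]mulr_natr; ring.
  by rewrite /expi (periodicn (@cosD2pi R)) (periodicn (@sinD2pi R)).
case: k => n; first exact: per.
by rewrite -[LHS](per n.+1); congr expi; rewrite NegzE mulrNz -pmulrn; ring.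
Qed.

Variables (sigma a xi0 xi1 : R).
Hypothesis sigma_gt0 : 0 < sigma.

Definition gauss_spectrum (xi eta : R) : R :=
  expR (- (pi ^+ 2 * sigma ^+ 2 * (eta - xi) ^+ 2)).

Let integrable_window_cos t b th : mu.-integrable setT
  (EFin \o (fun x => gaussian_window sigma (x - t) * cos (b * (x - t) + th))).
Proof.
apply: integrableM_bounded.
- exact: integrable_window.
- by move=> x; apply: (@continuous_comp _ _ _ (fun x => b * (x - t) + th) cos);
  [exact: continuous_affine|exact: continuous_cos].
- by move=> x; exact: cos_max.
Qed.

(** Relative to the window centre, the tone of frequency xi has frequency xi - eta
    and initial phase 2 pi xi t. The real part of the transform is the case th = 0
    and the imaginary part the case th = - pi / 2. *)
Let window_two_tone t eta th :
  \int[mu]_(x in setT) (gaussian_window sigma (x - t) *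
    (cos (2 * pi * xi0 * x - 2 * pi * eta * (x - t) + th) +
     a * cos (2 * pi * xi1 * x - 2 * pi * eta * (x - t) + th))) =
  gauss_spectrum xi0 eta * cos (2 * pi * xi0 * t + th) +
  a * (gauss_spectrum xi1 eta * cos (2 * pi * xi1 * t + th)).
Proof.
have E xi : gauss_spectrum xi eta * cos (2 * pi * xi * t + th) =
  \int[mu]_(x in setT) (gaussian_window sigma (x - t) *
    cos (2 * pi * (xi - eta) * (x - t) + (2 * pi * xi * t + th))).
  by rewrite Rintegral_window_cos//; congr (expR _ * _); field.
rewrite !E -RintegralZl// -RintegralD//.
2: by rewrite /comp; under eq_fun do rewrite EFinM;
   apply: (integrableZl _ _ (integrable_window_cos _ _ _)).
apply: eq_Rintegral => x _; rewrite mulrDr [in RHS](mulrCA a).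
by congr (_ * cos _ + _ * (_ * cos _)); ring.
Qed.

Lemma stft_two_toneE t eta :
  stft (gaussian_window sigma) (two_tone a xi0 xi1) t eta =
  expi (2 * pi * xi0 * t) * ((gauss_spectrum xi0 eta)%:C +
    a%:C * expi (2 * pi * (xi1 - xi0) * t) * (gauss_spectrum xi1 eta)%:C)%C.
Proof.
have -> : expi (2 * pi * xi0 * t) * ((gauss_spectrum xi0 eta)%:C +
    a%:C * expi (2 * pi * (xi1 - xi0) * t) * (gauss_spectrum xi1 eta)%:C)%C =
  expi (2 * pi * xi0 * t) * (gauss_spectrum xi0 eta)%:C%C +
    a%:C%C * (expi (2 * pi * xi1 * t)) * (gauss_spectrum xi1 eta)%:C%C.
  have -> : 2 * pi * xi1 * t =
      2 * pi * xi0 * t + 2 * pi * (xi1 - xi0) * t by ring.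
  by rewrite expiD; ring.
rewrite /stft /cintegral.
have integrandE x : (two_tone a xi0 xi1 x * (gaussian_window sigma (x - t))%:C *
    expi (- (2 * pi * eta * (x - t))) =
  (gaussian_window sigma (x - t))%:C *
   (expi (2 * pi * xi0 * x - 2 * pi * eta * (x - t)) +
    a%:C * expi (2 * pi * xi1 * x - 2 * pi * eta * (x - t))))%C.
  by rewrite /two_tone !expiD; ring.
have -> : (\int[mu]_(x in setT) complex.Re (two_tone a xi0 xi1 x *
    (gaussian_window sigma (x - t))%:C%C * expi (- (2 * pi * eta * (x - t))))) =
  gauss_spectrum xi0 eta * cos (2 * pi * xi0 * t + 0) +
  a * (gauss_spectrum xi1 eta * cos (2 * pi * xi1 * t + 0)).
  rewrite -window_two_tone; apply: eq_Rintegral => x _.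
  by rewrite integrandE !addr0 /=; ring.
have -> : (\int[mu]_(x in setT) complex.Im (two_tone a xi0 xi1 x *
    (gaussian_window sigma (x - t))%:C%C * expi (- (2 * pi * eta * (x - t))))) =
  gauss_spectrum xi0 eta * cos (2 * pi * xi0 * t - pi / 2) +
  a * (gauss_spectrum xi1 eta * cos (2 * pi * xi1 * t - pi / 2)).
  rewrite -window_two_tone; apply: eq_Rintegral => x _.
  by rewrite integrandE !cosBpihalf /=; ring.
rewrite !cosBpihalf !addr0 /expi; simpc.
by congr Complex; ring.
Qed.

(** At t = k / (xi1 - xi0) the phase factor between the two tones is
    exp (2 pi i k) = 1, so the bumps add without interference. *)
Lemma cmodulus_stft_constructive_time (k : int) eta : xi0 < xi1 -> 0 < a ->
  cmodulus (stft (gaussian_window sigma) (two_tone a xi0 xi1)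
              (constructive_time (xi1 - xi0) k) eta) =
  gauss_spectrum xi0 eta + a * gauss_spectrum xi1 eta.
Proof.
move=> xi01 a0; rewrite stft_two_toneE /constructive_time.
set t := _ / _.
have -> : 2 * pi * (xi1 - xi0) * t = 0 + 2 * pi * k%:~R.
  by rewrite /t; field; rewrite subr_eq0 gt_eqF.
rewrite expiDint /expi cos0 sin0; simpc; rewrite /cmodulus /=.
rewrite !exprMn -mulrDl cos2Dsin2 mul1r sqrtr_sqr ger0_norm//.
by rewrite addr_ge0 ?mulr_ge0 ?expR_ge0 ?ltW.
Qed.

End stft_value.

(** * Crossings of the logit curve with a line *)

Section tilted_logit.
Context {R : realType}.

(** The height of the logit curve above the line of slope 2 c through (1/2, 0).
    The line through (1/2, lam) meets the curve where this height equals lam. *)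
Definition tilted_logit (c v : R) : R := ln v - ln (1 - v) - c * (2 * v - 1).

Lemma tilted_logit_sym (c v : R) : tilted_logit c (1 - v) = - tilted_logit c v.
Proof. by rewrite /tilted_logit (_ : 1 - (1 - v) = v); ring. Qed.

Lemma is_derive_tilted_logit (c v : R) : 0 < v < 1 ->
  is_derive v 1 (tilted_logit c) ((v * (1 - v))^-1 - 2 * c).
Proof.
move=> /andP[v0 v1]; have v1' : 0 < 1 - v by rewrite subr_gt0.
have d1 := is_derive1_ln v0; have d2 := is_derive1_ln v1'.
have d3 : is_derive v 1 (fun v : R => 1 - v) (- 1).
  by apply: is_derive_eq; ring.
have d4 : is_derive v 1 (fun v : R => ln (1 - v)) ((1 - v)^-1 * -1).
  exact: (@is_derive1_comp R (@ln R) (fun v : R => 1 - v) v _ _ d2 d3).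
rewrite /tilted_logit; apply: is_derive_eq; rewrite /GRing.scale/=; field.
by rewrite !gt_eqF.
Qed.

Lemma tilted_logit_mvt (c x y : R) : 0 < x -> x < y -> y < 1 ->
  exists2 z, x < z < y & tilted_logit c y - tilted_logit c x =
    ((z * (1 - z))^-1 - 2 * c) * (y - x).
Proof.
move=> x0 xy y1.
have [| |z] := @MVT _ (tilted_logit c) (fun z => (z * (1 - z))^-1 - 2 * c) x y xy.
- move=> z; rewrite in_itv/= => /andP[xz zy]; apply: is_derive_tilted_logit.
  by rewrite (lt_trans x0 xz) (lt_trans zy y1).
- apply: derivable_within_continuous => z; rewrite in_itv/= => /andP[xz zy].
  have /(is_derive_tilted_logit c)[//] : 0 < z < 1.
  by rewrite (lt_le_trans x0 xz) (le_lt_trans zy y1).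
- by rewrite in_itv/=; exists z.
Qed.

Variable (c : R).
Local Notation H := (tilted_logit c).

(** The slope of the logit curve at z is 1 / (z (1 - z)), which decreases on (0, 1/2];
    if it is still at least 2 c at b, it exceeds 2 c before b. *)
Lemma tilted_logit_incr b : 0 < b -> b <= 2^-1 -> 2 * c * (b * (1 - b)) <= 1 ->
  forall x y, 0 < x -> x < y -> y <= b -> H x < H y.
Proof.
move=> b0 b12 cb x y x0 xy yb; rewrite -subr_gt0.
have [|z /andP[xz zy] ->] := @tilted_logit_mvt c x y x0 xy; first by lra.
rewrite mulr_gt0 ?subr_gt0//.
have z0 : 0 < z * (1 - z) by nra.
rewrite -[X in _ < X]mul1r ltr_pdivlMr//.
have [c0|c0] := ltP 0 c; last by nra.
have : z * (1 - z) < b * (1 - b) by nra.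
nra.
Qed.

(** At b and 1 - b the logit curve has slope exactly 2 c; strictly between these two
    turning points it is flatter than the line. *)
Lemma tilted_logit_decr b : 0 < b -> 2 * c * (b * (1 - b)) = 1 ->
  forall x y, b <= x -> x < y -> y <= 1 - b -> H y < H x.
Proof.
move=> b0 cb x y bx xy yb; rewrite -subr_lt0.
have [||z /andP[xz zy] ->] := @tilted_logit_mvt c x y _ xy; [lra|lra|].
rewrite nmulr_rlt0 ?subr_gt0// subr_lt0.
have z0 : 0 < z * (1 - z) by nra.
rewrite -[X in X < _]mul1r ltr_pdivrMr//.
have : 0 < (z - b) * (1 - z - b) by rewrite mulr_gt0//; lra.
have c0 : 0 < c.
  have : 0 < 2 * c * (b * (1 - b)) by rewrite cb.
  by rewrite pmulr_lgt0; [lra|rewrite mulr_gt0//; lra].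
move=> /(mulr_gt0 c0); nra.
Qed.

(** The height tends to -oo at 0; the witness b exp (- M) lowers ln b by M, which
    outweighs the bounded remaining terms. *)
Lemma tilted_logit_low b lam : 0 < b < 1 -> exists2 v, 0 < v < b & H v < lam.
Proof.
move=> /andP[b0 b1]; set A := ln b - ln (1 - b) + `|c| - lam.
pose M := `|A| + 1; exists (b * expR (- M)).
  rewrite mulr_gt0 ?expR_gt0//= gtr_pMr// expR_lt1.
  by rewrite oppr_lt0 ltr_wpDl.
set v := b * _.
have eM : expR (- M) < 1 by rewrite expR_lt1 oppr_lt0 ltr_wpDl.
have e0 : 0 < expR (- M) by exact: expR_gt0.
have [v0 vb] : 0 < v /\ v < b by rewrite /v; nra.
have lnv : ln v = ln b - M by rewrite /v lnM ?posrE ?expR_gt0// expRK.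
have ln1v : ln (1 - b) <= ln (1 - v) by rewrite ler_ln ?posrE; lra.
have cv : - (c * (2 * v - 1)) <= `|c|.
  rewrite -mulrN; apply: le_trans (ler_norm _) _.
  by rewrite normrM ler_piMr// ler_norml; lra.
have := ler_norm A; rewrite /tilted_logit lnv /A /M; lra.
Qed.

Lemma tilted_logit_cross x y lam : 0 < x -> x <= y -> y < 1 ->
  Num.min (H x) (H y) <= lam <= Num.max (H x) (H y) ->
  exists2 z, x <= z <= y & H z = lam.
Proof.
move=> x0 xy y1 h.
have [z|z] := IVT xy _ h; last by rewrite in_itv/=; exists z.
apply: (derivable_within_continuous (f := H)) => {}z.
rewrite in_itv/= => /andP[xz zy].
have /(is_derive_tilted_logit c)[//] : 0 < z < 1.
by rewrite (lt_le_trans x0 xz) (le_lt_trans zy y1).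
Qed.

Lemma tilted_logit_first_cross b lam : 0 < b < 1 ->
  (forall x y, 0 < x -> x < y -> y <= b -> H x < H y) -> lam <= H b ->
  exists m, [/\ 0 < m <= b,
    forall x, 0 < x < m -> H x < lam & forall x, m < x <= b -> lam < H x].
Proof.
move=> b01 inc lamb; have [v /andP[v0 vb] Hv] := tilted_logit_low _ lam b01.
have /andP[b0 b1] := b01.
have [|m /andP[vm mb] Hm] := @tilted_logit_cross v b lam v0 (ltW vb) b1.
  by rewrite ge_min le_max lamb (ltW Hv) orbT.
exists m; split => [|x /andP[x0 xm]|x /andP[mx xb]].
- by rewrite mb (lt_le_trans v0 vm).
- by rewrite -Hm; exact: inc.
- by rewrite -Hm; apply: inc => //; exact: lt_le_trans v0 vm.
Qed.

(** If lam is not above the value at the turning point 1 - b, then on [b, 1) the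
    height reaches lam at most at 1 - b, and the only crossing is in (0, b]. The
    other alternative is its mirror image under v -> 1 - v. The point p is where the
    line may touch the curve without crossing it. *)
Lemma tilted_logit_one_cross b lam : 0 < b <= 2^-1 ->
  (forall x y, 0 < x -> x < y -> y <= b -> H x < H y) ->
  (forall x y, b <= x -> x < y -> y <= 1 - b -> H y < H x) ->
  lam <= H (1 - b) \/ H b <= lam ->
  exists m p, [/\ 0 < m < 1,
    forall x, 0 < x < m -> x != p -> H x < lam &
    forall x, m < x < 1 -> x != p -> lam < H x].
Proof.
move=> /andP[b0 b12] inc dec.
have below l : l <= H (1 - b) -> exists m p, [/\ 0 < m < 1,
    forall x, 0 < x < m -> x != p -> H x < l &
    forall x, m < x < 1 -> x != p -> l < H x].
  move=> lb.
  have lb' : l <= H b.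
    have [e|bb] := eqVneq b (1 - b); first by rewrite e.
    by rewrite (le_trans lb)// ltW// dec//; lra.
  have [|m [/andP[m0 mb] lo hi]] := @tilted_logit_first_cross b l _ inc lb'.
    by lra.
  exists m, (1 - b); split; [by lra|by move=> x xm _; exact: lo|].
  move=> x /andP[mx x1] xp.
  have [xb|xb] := leP x b; first by apply: hi; rewrite mx.
  have [xb'|xb'] := ltP x (1 - b); first by rewrite (le_lt_trans lb)// dec// ltW.
  apply: (le_lt_trans lb).
  rewrite -ltrN2 -!tilted_logit_sym; apply: inc; rewrite ?subr_gt0//; last lra.
  by rewrite ltrD2l ltrN2 lt_neqAle eq_sym xp.
case=> [/below//|lb].
have [|m [p [/andP[m0 m1] lo hi]]] := below (- lam).
  by rewrite tilted_logit_sym lerN2.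
exists (1 - m), (1 - p); split; [by lra| |] => x /andP[x0 x1] xp.
- rewrite -ltrN2 -tilted_logit_sym; apply: hi; first by lra.
  by apply: contra_neq xp => <-; ring.
- rewrite -ltrN2 -tilted_logit_sym; apply: lo; first by lra.
  by apply: contra_neq xp => <-; ring.
Qed.

(** A level strictly between the values at the two turning points is crossed once in
    each of the three intervals that they delimit; the crossing after 1 - b is the
    mirror image of the crossing of - lam before b. *)
Lemma tilted_logit_three_cross b lam : 0 < b < 2^-1 ->
  (forall x y, 0 < x -> x < y -> y <= b -> H x < H y) ->
  (forall x y, b <= x -> x < y -> y <= 1 - b -> H y < H x) ->
  H (1 - b) < lam < H b ->
  exists m1 n m2, [/\ [/\ 0 < m1, m1 < n, n < m2 & m2 < 1],
    forall x, 0 < x < m1 -> H x < lam,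
    forall x, m1 < x < n -> lam < H x,
    forall x, n < x < m2 -> H x < lam &
    forall x, m2 < x < 1 -> lam < H x].
Proof.
move=> /andP[b0 b12] inc dec /andP[lamlo lamhi].
have b01 : 0 < b < 1 by lra.
have [m1 [/andP[m10 m1b] lo1 hi1]] :=
  tilted_logit_first_cross _ _ b01 inc (ltW lamhi).
have [|m2 [/andP[m20 m2b] lo2 hi2]] :=
  @tilted_logit_first_cross b (- lam) b01 inc.
  by rewrite -(opprK (H b)) -tilted_logit_sym lerN2 ltW.
have [|||n /andP[bn nb] Hn] := @tilted_logit_cross b (1 - b) lam b0;
  [lra|lra| |].
  by rewrite ge_min le_max (ltW lamlo) (ltW lamhi) orbT.
have nb1 : b != n by apply: contra_ltN lamhi => /eqP ->; rewrite Hn.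
have nb2 : n != 1 - b by apply: contra_ltN lamlo => /eqP <-; rewrite Hn.
have {}bn : b < n by rewrite lt_neqAle nb1.
have {}nb : n < 1 - b by rewrite lt_neqAle nb2.
exists m1, n, (1 - m2); split; [split; lra|by []| | |] => x /andP[x0 x1].
- have [xb|xb] := leP x b; first by apply: hi1; rewrite x0.
  by rewrite -Hn dec// ltW// (lt_trans _ nb).
- have [xb|xb] := leP x (1 - b); first by rewrite -Hn dec// ltW.
  by rewrite -ltrN2 -tilted_logit_sym; apply: hi2; lra.
- by rewrite -ltrN2 -tilted_logit_sym; apply: lo2; lra.
Qed.

End tilted_logit.

(** * The critical slope *)

Section critical_tilt.
Context {R : realType}.

Lemma tilted_logit_half (c : R) : tilted_logit c 2^-1 = 0.
Proof.
by rewrite /tilted_logit (_ : 1 - 2^-1 = 2^-1 :> R); [field|lra].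
Qed.

(** The minimal slope of the logit curve is 4, at 1/2; the steeper slope 2 c is
    attained at the roots of v^2 - v + 1 / (2 c), of which b is the smaller. *)
Lemma tilted_logit_fold (c : R) : 2 < c ->
  exists2 b, 0 < b < 2^-1 & 2 * c * (b * (1 - b)) = 1.
Proof.
move=> c2; have c0 : 0 < c by lra.
have ic : c^-1 < 2^-1 by rewrite ltf_pV2 ?posrE.
have ic0 : 0 < c^-1 by rewrite invr_gt0.
have d0 : 0 < 1 - 2 / c by lra.
have e : Num.sqrt (1 - 2 / c) ^+ 2 = 1 - 2 / c by rewrite sqr_sqrtr ?ltW.
have r0 : 0 < Num.sqrt (1 - 2 / c) by rewrite sqrtr_gt0.
set r := Num.sqrt _ in e r0.
have r1 : r < 1 by nra.
exists ((1 - r) / 2); first by lra.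
have -> : 2 * c * ((1 - r) / 2 * (1 - (1 - r) / 2)) = c / 2 * (1 - r ^+ 2) by field.
by rewrite e; field; rewrite gt_eqF.
Qed.

Variables (c0 p : R).
Hypotheses (p01 : 0 < p < 1) (tangent : 2 * c0 * (p * (1 - p)) = 1).

Let fold_lt (c1 c2 u v : R) : 0 < c1 -> 0 < v ->
  2 * c1 * u = 1 -> 2 * c2 * v = 1 -> (c1 < c2 -> v < u) /\ (c1 <= c2 -> v <= u).
Proof.
move=> c10 v0 e1 e2; have c1' : 0 < 2 * c1 by lra.
split=> h.
  by rewrite -(ltr_pM2l c1') e1 -[ltRHS]e2 ltr_pM2r//; lra.
by rewrite -(ler_pM2l c1') e1 -[leRHS]e2 ler_pM2r//; lra.
Qed.

Let critical_tilt_ge2 : 2 <= c0.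
Proof.
have /andP[p0 p1] := p01; have h : 0 <= (2 * p - 1) ^+ 2 by exact: sqr_ge0.
have q0 : 0 < p * (1 - p) by rewrite mulr_gt0 ?subr_gt0.
have q4 : p * (1 - p) <= 4^-1 by lra.
rewrite leNgt; apply/negP => c2.
have : 2 * c0 * (p * (1 - p)) < 4 * (p * (1 - p)) by rewrite ltr_pM2r//; lra.
by rewrite tangent; lra.
Qed.

(** Suppose p <= 1/2 (the other case is the mirror image). Flattening the line from
    slope 2 c0 to 2 c moves the turning point b to p or to its right. Now p is a turning
    point for c0, so the height for c0 does not increase from p to b, and lowering
    the slope to 2 c lowers the height left of 1/2; hence the value at b is at most
    the level, which is the height for c0 at p. *)
Lemma subcritical_one_cross c : c <= c0 ->
  exists m q, [/\ 0 < m < 1,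
    forall x, 0 < x < m -> x != q -> tilted_logit c x < tilted_logit c0 p &
    forall x, m < x < 1 -> x != q -> tilted_logit c0 p < tilted_logit c x].
Proof.
move=> cc0; have /andP[p0 p1] := p01.
(* for c <= 2 the height is increasing throughout, and 1/2 serves as both turning
   points *)
have [b [b0 b12 bp1 bp2 cb]] : exists b, [/\ 0 < b, b <= 2^-1,
    (p <= 2^-1 -> p <= b), (2^-1 <= p -> 1 - p <= b) &
    b = 2^-1 /\ c <= 2 \/ 2 * c * (b * (1 - b)) = 1].
  have [c2|c2] := leP c 2; first by exists 2^-1; split; lra.
  have [b b012 cb] := tilted_logit_fold _ c2.
  have pb : p * (1 - p) <= b * (1 - b).
    by apply: (fold_lt _ _ _ _ _ _ cb tangent).2 => //;
      [lra|rewrite mulr_gt0//; lra].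
  exists b; split; [lra|lra| | |by right] => p12; rewrite leNgt; apply/negP => h.
    have : 0 < (p - b) * (1 - p - b) by rewrite mulr_gt0//; lra.
    nra.
  have : 0 < (p - b) * (1 - p - b) by rewrite mulr_gt0//; lra.
  nra.
apply: (@tilted_logit_one_cross _ c b).
- by rewrite b0.
- apply: tilted_logit_incr => //; case: cb => [[-> c2]|->//].
  lra.
- case: cb => [[-> _]|cb]; first by move=> x y; lra.
  exact: tilted_logit_decr.
- have key (l q : R) : 0 < q -> 2 * c0 * (q * (1 - q)) = 1 -> q <= b ->
      l = tilted_logit c0 q -> tilted_logit c b <= l.
    move=> q0 qc qb ->; apply: (@le_trans _ _ (tilted_logit c0 b)).
      by rewrite /tilted_logit lerD2l lerN2; nra.
    have [->//|qb'] := eqVneq q b; apply/ltW/(tilted_logit_decr _ _ q0 qc) => //.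
      by rewrite lt_neqAle qb'.
    by lra.
  have [p12|p12] := leP p 2^-1; [right|left].
    by apply: (key _ p) => //; exact: bp1.
  rewrite tilted_logit_sym lerNr; apply: (key _ (1 - p)).
  + lra.
  + by rewrite -[RHS]tangent; ring.
  + by apply: bp2; exact: ltW.
  + by rewrite tilted_logit_sym.
Qed.

(** Suppose p <= 1/2 (the other case is the mirror image). Steepening the line moves
    the turning point b to the left of p. Left of 1/2 a steeper line raises the
    height, so the level is at most the height for c at p, which is below that at b.
    The level is also nonnegative, as the height for c0 decreases from p to 1/2,
    while the height for c at 1 - b is below its value 0 at 1/2. *)
Lemma supercritical_three_cross c : c0 < c ->
  exists m1 n m2, [/\ [/\ 0 < m1, m1 < n, n < m2 & m2 < 1],
    forall x, 0 < x < m1 -> tilted_logit c x < tilted_logit c0 p,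
    forall x, m1 < x < n -> tilted_logit c0 p < tilted_logit c x,
    forall x, n < x < m2 -> tilted_logit c x < tilted_logit c0 p &
    forall x, m2 < x < 1 -> tilted_logit c0 p < tilted_logit c x].
Proof.
move=> cc0; have /andP[p0 p1] := p01.
have c2 : 2 < c by apply: le_lt_trans cc0.
have [b b012 cb] := tilted_logit_fold _ c2.
have /andP[b0 b12] := b012.
have dec := tilted_logit_decr c b b0 cb.
have bp : b * (1 - b) < p * (1 - p).
  have c00 : 0 < c0 by apply: lt_le_trans critical_tilt_ge2; lra.
  by apply: (fold_lt _ _ _ _ _ _ tangent cb).1 => //; rewrite mulr_gt0//; lra.
apply: (@tilted_logit_three_cross _ c b) => //.
  by apply: tilted_logit_incr => //; [lra|rewrite cb].
have key (q : R) : q <= 2^-1 -> 0 < q -> 2 * c0 * (q * (1 - q)) = 1 ->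
    b * (1 - b) < q * (1 - q) ->
    tilted_logit c (1 - b) < tilted_logit c0 q < tilted_logit c b.
  move=> q12 q0 qc bq; apply/andP; split.
    apply: (@lt_le_trans _ _ 0).
      by rewrite -(tilted_logit_half c) dec//; lra.
    rewrite -(tilted_logit_half c0); have [->//|q12'] := eqVneq q 2^-1.
    apply/ltW/(tilted_logit_decr _ _ q0 qc) => //; first by rewrite lt_neqAle q12'.
    by lra.
  apply: (@le_lt_trans _ _ (tilted_logit c q)).
    by rewrite /tilted_logit lerD2l lerN2; nra.
  by apply: dec => //; [rewrite ltNge; apply/negP => h; nra|lra].
have [p12|p12] := leP p 2^-1; first by apply: key => //; case/andP: p01.
have /andP[] : tilted_logit c (1 - b) < tilted_logit c0 (1 - p) < tilted_logit c b.
  apply: key; [lra|lra|by rewrite -[RHS]tangent; ring|].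
  by rewrite (_ : (1 - p) * _ = p * (1 - p)) //; ring.
by rewrite !tilted_logit_sym ltrN2 ltrNl => -> ->.
Qed.

End critical_tilt.

(** * Counting local maxima from the sign of the derivative *)

Section local_maxima.
Context {R : realType}.
Variables (f df : R -> R).
Hypothesis fd : forall x : R, is_derive x 1 f (df x).

Let cf x y : {within `[x, y], continuous f}.
Proof.
apply: continuous_subspaceT => z.
by apply/differentiable_continuous/derivable1_diffP; have [] := fd z.
Qed.

Let mvt x y : x < y -> exists2 z, x < z < y & f y - f x = df z * (y - x).
Proof.
move=> xy; have [z + e] := MVT xy (fun z _ => fd z) (cf x y).
by rewrite in_itv/=; exists z.
Qed.

Lemma local_maximum_derive_sign y x z : y < x < z ->
  (forall u, y < u < x -> 0 <= df u) -> (forall u, x < u < z -> df u <= 0) ->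
  local_maximum f x.
Proof.
move=> yxz dfl dfr; have : x \in `]y, z[ by rewrite in_itv.
move=> /near_in_itvoo; apply: filterS => u; rewrite in_itv/= => /andP[yu uz].
rewrite -subr_ge0; have [ux|xu|->] := ltgtP u x; last by rewrite subrr.
- have [v /andP[uv vx] ->] := mvt _ _ ux.
  by rewrite mulr_ge0 ?subr_ge0 ?(ltW ux)// dfl// vx (lt_trans yu).
- have [v /andP[xv vu] e] := mvt _ _ xu.
  rewrite -opprB e -mulNr mulr_ge0 ?subr_ge0 ?(ltW xu)// oppr_ge0 dfr// xv.
  exact: lt_trans vu uz.
Qed.

Lemma not_local_maximum_incr x z : x < z ->
  (forall u, x < u < z -> 0 < df u) -> ~ local_maximum f x.
Proof.
move=> xz dfp lx.
have : \forall u \near x^'+, f u <= f x by exact: cvg_within.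
move=> fle; near x^'+ => u.
have xu : x < u by [].
have uz : u < z by near: u; exact: nbhs_right_lt.
have [v /andP[xv vu] e] := mvt _ _ xu.
have : 0 < f u - f x by rewrite e mulr_gt0 ?subr_gt0// dfp// xv (lt_trans vu).
by rewrite subr_gt0 ltNge; apply/negP/negPn; near: u.
Unshelve. all: end_near. Qed.

Lemma not_local_maximum_decr y x : y < x ->
  (forall u, y < u < x -> df u < 0) -> ~ local_maximum f x.
Proof.
move=> yx dfn lx.
have : \forall u \near x^'-, f u <= f x by exact: cvg_within.
move=> fle; near x^'- => u.
have ux : u < x by [].
have yu : y < u by near: u; exact: nbhs_left_gt.
have [v /andP[uv vx] e] := mvt _ _ ux.
have : f x - f u < 0 by rewrite e nmulr_rlt0 ?subr_gt0// dfn// vx (lt_trans yu).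
by rewrite subr_lt0 ltNge; apply/negP/negPn; near: u.
Unshelve. all: end_near. Qed.

(** The derivative may vanish at the exceptional point p: near any point there are
    one-sided intervals that avoid p, and the sign on these decides. *)
Lemma one_local_maximum m p :
  (forall x, x < m -> x != p -> 0 < df x) ->
  (forall x, m < x -> x != p -> df x < 0) ->
  has_n_local_maxima 1 f.
Proof.
move=> up down; rewrite /has_n_local_maxima.
suff -> : [set x | local_maximum f x] = [set m] by exact: card_set1.
apply/seteqP; split => x /=.
  move=> lx; apply/eqP; case: ltgtP => // h; exfalso; move: lx.
    have [xp|px] := ltP x p.
      apply: (@not_local_maximum_incr _ (Num.min p m)); first by rewrite lt_min xp.
      move=> u; rewrite lt_min => /and3P[xu up' um].
      by apply: up => //; rewrite lt_eqF.
    apply: (@not_local_maximum_incr _ m) => // u /andP[xu um].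
    by apply: up => //; rewrite gt_eqF// (le_lt_trans px).
  have [px|xp] := ltP p x.
    apply: (@not_local_maximum_decr (Num.max p m)); first by rewrite gt_max px.
    move=> u; rewrite gt_max => /andP[/andP[pu mu] ux].
    by apply: down => //; rewrite gt_eqF.
  apply: (@not_local_maximum_decr m) => // u /andP[mu ux].
  by apply: down => //; rewrite lt_eqF// (lt_le_trans ux).
move=> ->; pose y := if p < m then p else m - 1.
pose z := if m < p then p else m + 1.
apply: (@local_maximum_derive_sign y m z).
- apply/andP; split; first by rewrite /y; case: ifPn => // _; rewrite gtrBl.
  by rewrite /z; case: ifPn => // _; rewrite ltrDl.
- rewrite /y => u /andP[yu um]; apply/ltW/up => //.
  by move: yu; case: ifPn => [_ pu|]; [rewrite gt_eqF|rewrite -leNgt => mp _;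
     rewrite lt_eqF// (lt_le_trans um)].
- rewrite /z => u /andP[mu uz]; apply/ltW/down => //.
  by move: uz; case: ifPn => [_ up'|]; [rewrite lt_eqF|rewrite -leNgt => mp _;
     rewrite gt_eqF// (le_lt_trans mp)].
Qed.

Lemma two_local_maxima m1 n m2 : m1 < n -> n < m2 ->
  (forall x, x < m1 -> 0 < df x) -> (forall x, m1 < x < n -> df x < 0) ->
  (forall x, n < x < m2 -> 0 < df x) -> (forall x, m2 < x -> df x < 0) ->
  has_n_local_maxima 2 f.
Proof.
move=> m1n nm2 up1 down1 up2 down2; rewrite /has_n_local_maxima.
have -> : [set x | local_maximum f x] = [set m1; m2].
  apply/seteqP; split => x /=.
    move=> lx; have [xm1|m1x|->] := ltgtP x m1; last by left.
      exfalso; move: lx; apply: (@not_local_maximum_incr _ m1) => // u /andP[_].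
      exact: up1.
    have [xn|nx] := leP x n.
      exfalso; move: lx; apply: (@not_local_maximum_decr m1) => // u /andP[mu ux].
      by apply: down1; rewrite mu (lt_le_trans ux).
    have [xm2|m2x|->] := ltgtP x m2; last by right.
      exfalso; move: lx; apply: (@not_local_maximum_incr _ m2) => // u /andP[xu um].
      by apply: up2; rewrite um (lt_trans nx).
    exfalso; move: lx; apply: (@not_local_maximum_decr m2) => // u /andP[mu _].
    exact: down2.
  case=> ->.
  - apply: (@local_maximum_derive_sign (m1 - 1) m1 n).
    + by rewrite gtrBl ltr01.
    + by move=> u /andP[_ um]; apply/ltW/up1.
    + by move=> u um; apply/ltW/down1.
  - apply: (@local_maximum_derive_sign n m2 (m2 + 1)).
    + by rewrite nm2 ltrDl ltr01.
    + by move=> u um; apply/ltW/up2.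
    + by move=> u /andP[um _]; apply/ltW/down2.
apply/eq_cardSP; exists m1; first by left.
rewrite (_ : _ `\ m1 = [set m2]); first exact: card_set1.
apply/seteqP; split => x /=; first by move=> [[->|->] //].
move=> ->; split; first by right.
by apply/eqP; rewrite gt_eqF// (lt_trans m1n).
Qed.

End local_maxima.

Section change_of_variable.
Context {R : realType}.

Lemma local_maximum_comp (g phi : R -> R) x : {for x, continuous phi} ->
  local_maximum g (phi x) -> local_maximum (g \o phi) x.
Proof. by move=> cphi lg; exact: cphi lg. Qed.

Lemma has_n_local_maxima_comp n (g phi psi : R -> R) :
  continuous phi -> continuous psi -> cancel phi psi -> cancel psi phi ->
  has_n_local_maxima n g -> has_n_local_maxima n (g \o phi).
Proof.
move=> cphi cpsi phiK psiK; rewrite /has_n_local_maxima.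
have -> : [set x | local_maximum (g \o phi) x] =
    psi @` [set x | local_maximum g x].
  apply/seteqP; split => x /=.
    move=> lx; exists (phi x); last exact: phiK.
    have -> : g = (g \o phi) \o psi by apply/funext => y /=; rewrite psiK.
    by apply: local_maximum_comp; [exact: cpsi|rewrite phiK].
  move=> [y ly <-]; apply: local_maximum_comp; [exact: cphi|by rewrite psiK].
move=> h; apply: card_eq_trans h; apply: inj_card_eq => y z _ _.
exact: (can_inj psiK).
Qed.

End change_of_variable.

(** * The sum of two Gaussian bumps *)

Section gaussian_mixture.
Context {R : realType}.
Variables (c a : R).
Hypotheses (c_gt0 : 0 < c) (a_gt0 : 0 < a).

Definition mixture (v : R) : R :=
  expR (- (c * v ^+ 2)) + a * expR (- (c * (1 - v) ^+ 2)).

Definition mixture_slope (v : R) : R :=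
  2 * c * (a * (1 - v) * expR (- (c * (1 - v) ^+ 2)) - v * expR (- (c * v ^+ 2))).

Lemma is_derive_mixture (v : R) : is_derive v 1 mixture (mixture_slope v).
Proof.
by rewrite /mixture; apply: is_derive_eq; rewrite /GRing.scale/= /mixture_slope; ring.
Qed.

Lemma mixture_slope_gt0 v : v <= 0 -> 0 < mixture_slope v.
Proof.
move=> v0; rewrite /mixture_slope mulr_gt0 ?mulr_gt0// subr_gt0.
apply: (@le_lt_trans _ _ 0); first by rewrite mulr_le0_ge0 ?expR_ge0.
by rewrite !mulr_gt0 ?expR_gt0//; lra.
Qed.

Lemma mixture_slope_lt0 v : 1 <= v -> mixture_slope v < 0.
Proof.
move=> v1; rewrite /mixture_slope pmulr_rlt0 ?mulr_gt0// subr_lt0.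
apply: (@le_lt_trans _ _ 0); last by rewrite mulr_gt0 ?expR_gt0//; lra.
by rewrite mulr_le0_ge0 ?expR_ge0// mulr_ge0_le0 ?(ltW a_gt0)//; lra.
Qed.

(** The slope is a difference of two positive terms; comparing their logarithms
    gives ln a + ln (1 - v) - c (1 - v)^2 against ln v - c v^2. *)
Lemma mixture_slope_sign v : 0 < v < 1 ->
  ((0 < mixture_slope v) = (tilted_logit c v < ln a)) *
  ((mixture_slope v < 0) = (ln a < tilted_logit c v)).
Proof.
move=> /andP[v0 v1]; have v1' : 0 < 1 - v by rewrite subr_gt0.
have c2 : 0 < 2 * c by rewrite mulr_gt0.
rewrite /mixture_slope pmulr_rgt0// pmulr_rlt0// subr_gt0 subr_lt0.
have -> : v * expR (- (c * v ^+ 2)) = expR (ln v - c * v ^+ 2).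
  by rewrite expRD lnK.
have -> : a * (1 - v) * expR (- (c * (1 - v) ^+ 2)) =
    expR (ln a + ln (1 - v) - c * (1 - v) ^+ 2).
  by rewrite !expRD !lnK.
by rewrite !ltr_expR /tilted_logit; split; apply/idP/idP; lra.
Qed.

Section number_of_maxima.
Variables (c0 p : R).
Hypotheses (p01 : 0 < p < 1) (tangent : 2 * c0 * (p * (1 - p)) = 1).
Hypothesis lna : ln a = tilted_logit c0 p.

Lemma mixture_one_maximum : c <= c0 -> has_n_local_maxima 1 mixture.
Proof.
move=> cc0.
have [m [q [/andP[m0 m1]]]] := subcritical_one_cross _ _ p01 tangent _ cc0.
rewrite -lna => lo hi.
apply: (one_local_maximum _ _ is_derive_mixture m q) => x xm xq.
- have [x0|x0] := leP x 0; first exact: mixture_slope_gt0.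
  by rewrite mixture_slope_sign ?lo ?x0// (lt_trans xm).
- have [x1|x1] := leP 1 x; first exact: mixture_slope_lt0.
  by rewrite mixture_slope_sign ?hi ?x1 ?xm// (lt_trans m0).
Qed.

Lemma mixture_two_maxima : c0 < c -> has_n_local_maxima 2 mixture.
Proof.
move=> cc0.
have [m1 [n [m2 [[m10 m1n nm2 m21]]]]] :=
  supercritical_three_cross _ _ p01 tangent _ cc0.
rewrite -lna => lo1 hi1 lo2 hi2.
have n0 : 0 < n by exact: lt_trans m1n.
have n1 : n < 1 by exact: lt_trans m21.
apply: (two_local_maxima _ _ is_derive_mixture m1 n m2) => // x.
- move=> xm; have [x0|x0] := leP x 0; first exact: mixture_slope_gt0.
  rewrite mixture_slope_sign ?lo1 ?x0//.
  by rewrite (lt_trans xm)// (lt_trans m1n).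
- move=> /andP[mx xn]; rewrite mixture_slope_sign ?hi1 ?mx//.
  by rewrite (lt_trans m10)// (lt_trans xn).
- move=> /andP[nx xm]; rewrite mixture_slope_sign ?lo2 ?nx//.
  by rewrite (lt_trans n0)// (lt_trans xm).
- move=> mx; have [x1|x1] := leP 1 x; first exact: mixture_slope_lt0.
  rewrite mixture_slope_sign ?hi2 ?mx//.
  by rewrite x1 (lt_trans n0)// (lt_trans nm2).
Qed.

End number_of_maxima.
End gaussian_mixture.

(** * The critical frequency gap *)

Section critical_frequency_gap.
Context {R : realType}.

(** With p = s / (1 + s) the odds p / (1 - p) are s, and the tangent to the logit curve
    at p rises by (s - 1 / s) / 2 from 1/2 to p. The equation for s thus says that
    this tangent has height ln a at 1/2. *)
Lemma ln_amplitude_tangent (a s : R) : 0 < a -> 0 < s ->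
  ln (s / a) = 2^-1 * (s - s^-1) ->
  ln a = tilted_logit ((1 + s) ^+ 2 / (2 * s)) (s / (1 + s)).
Proof.
move=> a0 s0; have s1 : 0 < 1 + s by lra.
rewrite ln_div// => e; rewrite /tilted_logit.
have -> : 1 - s / (1 + s) = (1 + s)^-1 by field; rewrite gt_eqF.
rewrite ln_div// lnV// opprK.
have -> : (1 + s) ^+ 2 / (2 * s) * (2 * (s / (1 + s)) - 1) = 2^-1 * (s - s^-1).
  by field; rewrite !gt_eqF.
by rewrite -e; ring.
Qed.

Lemma le_Delta_critical_STFT (sigma s D : R) : 0 < sigma -> 0 < s -> 0 < D ->
  (D <= Delta_critical_STFT sigma s) =
  (pi ^+ 2 * sigma ^+ 2 * D ^+ 2 <= (1 + s) ^+ 2 / (2 * s)).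
Proof.
move=> sigma0 s0 D0; rewrite /Delta_critical_STFT.
have s2 : 0 < 2 * s by lra.
have q0 : 0 < Num.sqrt (2 * s) by rewrite sqrtr_gt0.
have ps0 : 0 < pi * sigma :> R by rewrite mulr_gt0 ?pi_gt0.
rewrite (ler_pdivlMr _ _ (mulr_gt0 ps0 q0)) (ler_pdivlMr _ _ s2).
rewrite -[LHS](@ler_pXn2r _ 2) ?nnegrE//; last 2 first.
- by rewrite ltW// mulr_gt0// mulr_gt0.
- by rewrite addr_ge0 ?ltW.
by congr (_ <= _); rewrite !exprMn sqr_sqrtr ?ltW//; ring.
Qed.

End critical_frequency_gap.

Theorem lemma1 (R : realType) (sigma a xi0 xi1 Delta s : R)
    (hsigma : 0 < sigma) (ha : 0 < a) (hxi : xi0 < xi1)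
    (hDelta : Delta = xi1 - xi0)
    (hs : 0 < s) (hs_eq : ln (s / a) = 2^-1 * (s - s^-1)) (k : int) :
  let g := fun eta : R =>
    cmodulus (stft (gaussian_window sigma) (two_tone a xi0 xi1)
                   (constructive_time Delta k) eta) in
  (Delta <= Delta_critical_STFT sigma s -> has_n_local_maxima 1 g) /\
  (Delta_critical_STFT sigma s < Delta -> has_n_local_maxima 2 g).
Proof.
move=> g; have D0 : 0 < Delta by rewrite hDelta subr_gt0.
pose c := pi ^+ 2 * sigma ^+ 2 * Delta ^+ 2.
have c0 : 0 < c by rewrite !mulr_gt0 ?exprn_gt0 ?pi_gt0.
pose phi (eta : R) := (eta - xi0) / Delta.
pose psi (v : R) := v * Delta + xi0.
have gE : g = mixture c a \o phi.
  apply/funext => eta.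
  rewrite /g {1}hDelta cmodulus_stft_constructive_time//.
  rewrite /gauss_spectrum /mixture /c /phi /=.
  have Dn : xi1 - xi0 != 0 by rewrite subr_eq0 gt_eqF.
  by congr (expR (- _) + a * expR (- _)); rewrite hDelta; field.
have s1 : 0 < 1 + s by rewrite addr_gt0.
have p01 : 0 < s / (1 + s) < 1.
  by rewrite divr_gt0//= ltr_pdivrMr// mul1r ltrDr.
have tangent : 2 * ((1 + s) ^+ 2 / (2 * s)) *
    (s / (1 + s) * (1 - s / (1 + s))) = 1.
  by field; rewrite !gt_eqF.
have lna := ln_amplitude_tangent _ _ ha hs hs_eq.
have transport n : has_n_local_maxima n (mixture c a) -> has_n_local_maxima n g.
  rewrite gE; apply: (has_n_local_maxima_comp n _ phi psi).
  - move=> x; apply/differentiable_continuous/derivable1_diffP.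
    exact: ex_derive.
  - move=> x; apply/differentiable_continuous/derivable1_diffP.
    exact: ex_derive.
  - by move=> x; rewrite /phi /psi divfK ?gt_eqF// subrK.
  - by move=> x; rewrite /phi /psi addrK mulfK ?gt_eqF.
rewrite real_ltNge ?num_real// le_Delta_critical_STFT// -/c.
split => [cle|cgt]; apply: transport.
  exact: (mixture_one_maximum _ _ c0 ha _ _ p01 tangent lna).
by apply: (mixture_two_maxima _ _ c0 ha _ _ p01 tangent lna); rewrite ltNge.
Qed.
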